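(* Let $A$ be a finite alphabet and let $S\subseteq A^*$ be a uniformly recurrent set containing $A$. If, for every integer $d$, every finite $S$-maximal bifix code of $S$-degree $d$ has $d(\mathrm{Card}(A)-1)+1$ elements, then $S$ is neutral.
   Context: A set $S$ of words is factorial if it contains all factors of its elements. $S$ is uniformly recurrent if it is factorial, every word of $S$ has a right extension $wa\in S$ with $a\in A$, and for every $u\in S$ there is $n\ge1$ such that $u$ is a factor of every word of $S$ of length $n$. For $w\in S$ let $\ell(w)=\mathrm{Card}\{a\in A: aw\in S\}$, $r(w)=\mathrm{Card}\{a\in A: wa\in S\}$, $e(w)=\mathrm{Card}\{(a,b)\in A\times A: awb\in S\}$; $S$ is neutral if it is factorial and $e(w)=\ell(w)+r(w)-1$ for every $w\in S$. A prefix code is a set of nonempty words none of which is a proper prefix of another; suffix codes are defined symmetrically; a bifix code is both. A bifix code $X\subseteq S$ is $S$-maximal if it is not properly contained in any bifix code $Y\subseteq S$. A parse of a word $w$ with respect to $X$ is a triple $(v,x,u)$ with $w=vxu$, $v$ has no suffix in $X$, $u$ has no prefix in $X$, $x\in X^*$. The $S$-degree of $X$ is the maximal number of parses of a word of $S$. *)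

(* Defs.v *)
From mathcomp Require Export all_boot all_order all_algebra.
From mathcomp Require Export mathcomp_extra boolp classical_sets cardinality.

Set Implicit Arguments.
Unset Strict Implicit.
Unset Printing Implicit Defensive.

Local Open Scope classical_set_scope.
Local Open Scope card_scope.

Definition factorial_set (A : finType) (S : set (seq A)) : Prop :=
  forall u v : seq A, S v -> infix u v -> S u.

Definition uniformly_recurrent (A : finType) (S : set (seq A)) : Prop :=
  [/\ factorial_set S,
      forall w : seq A, S w -> exists a : A, S (rcons w a)
    & forall u : seq A, S u ->
        exists2 n : nat, (1 <= n)%N &
          forall w : seq A, S w -> size w = n -> infix u w].

Definition left_ext (A : finType) (S : set (seq A)) (w : seq A) : nat :=
  #|[pred a : A | `[< S (a :: w) >]]|.

Definition right_ext (A : finType) (S : set (seq A)) (w : seq A) : nat :=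
  #|[pred a : A | `[< S (rcons w a) >]]|.

Definition bi_ext (A : finType) (S : set (seq A)) (w : seq A) : nat :=
  #|[pred p : A * A | `[< S (p.1 :: rcons w p.2) >]]|.

(* Stated in int so that the subtraction is not truncated. *)
Definition neutral (A : finType) (S : set (seq A)) : Prop :=
  factorial_set S /\
  forall w : seq A, S w ->
    (bi_ext S w)%:Z%R = ((left_ext S w)%:Z + (right_ext S w)%:Z - 1)%R.

Definition prefix_code (A : finType) (X : set (seq A)) : Prop :=
  ~ X [::] /\
  forall x y : seq A, X x -> X y -> ~ (prefix x y /\ x <> y).

Definition suffix_code (A : finType) (X : set (seq A)) : Prop :=
  ~ X [::] /\
  forall x y : seq A, X x -> X y -> ~ (suffix x y /\ x <> y).

Definition bifix_code (A : finType) (X : set (seq A)) : Prop :=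
  prefix_code X /\ suffix_code X.

Definition maximal_bifix_code (A : finType) (S X : set (seq A)) : Prop :=
  [/\ bifix_code X, X `<=` S
    & forall Y : set (seq A), bifix_code Y -> Y `<=` S -> ~ X `<` Y].

Definition kleene_star (A : finType) (X : set (seq A)) : set (seq A) :=
  [set w | exists2 s : seq (seq A),
             (forall x : seq A, x \in s -> X x) & w = flatten s].

Definition parses (A : finType) (X : set (seq A)) (w : seq A) :
    set (seq A * seq A * seq A) :=
  [set p | let: (v, x, u) := p in
    [/\ w = v ++ x ++ u,
        forall y : seq A, X y -> ~ suffix y v,
        forall y : seq A, X y -> ~ prefix y u
      & kleene_star X x]].

(* The S-degree of X exists and equals d: the number of parses attains its
   maximum d on S. *)
Definition has_degree (A : finType) (S X : set (seq A)) (d : nat) : Prop :=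
  (exists2 w : seq A, S w & parses X w #= `I_d) /\
  forall w : seq A, S w -> parses X w #<= `I_d.

(* Main.v *)
Require Import Defs.
From mathcomp Require Import functions zify.

(** For n > 0 and a set P of words of length n, slide a window of length n along
    the words of S. The code [block_code S n P] consists of the words of S lying
    in P, and of the longer words of S whose windows are all in P but the
    first and the last one. If S has a word of length n outside P, this is a
    finite S-maximal bifix code of S-degree n + 1: a suffix of length at least n
    with no prefix in the code has all its later windows in P, so a word has at
    most one such suffix, and suffixes with no prefix in the code determine the
    parses. P empty gives the code of all words of S of length n + 1.

    For a word p of length n, compare the codes given by the four pairs
    (n, {p}), (n, empty), (n + 1, P'), (n + 1, empty), where P' is the set of
    words of length n + 1 both starting and ending with p. The codes (n, {p}) and
    (n + 1, P') share their words of length at least n + 3, and comparing lengths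
    n, n + 1, n + 2 shows that the alternating sum of the four cardinalities is
    1 + e(p) - l(p) - r(p). The hypothesis makes this sum 0. Using P' in place of
    the empty set is what handles the powers p = a^n of a letter. The empty word
    is handled by counting the words of length 2. *)

Set Implicit Arguments.
Unset Strict Implicit.
Unset Printing Implicit Defensive.

Local Open Scope classical_set_scope.
Local Open Scope card_scope.


(** * Windows of a word and the bifix codes they define *)

Definition block (A : finType) (n : nat) (u : seq A) (i : nat) : seq A :=
  take n (drop i u).

Definition block_code (A : finType) (S : set (seq A)) (n : nat)
    (P : pred (seq A)) : set (seq A) :=
  [set u | S u /\
    (size u = n /\ P u \/
     n < size u /\
       forall i, i + n <= size u -> P (block n u i) = (0 < i < size u - n))].

Lemma block_take (A : finType) n m (u : seq A) i :
  i + n <= m -> block n (take m u) i = block n u i.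
Proof. by move=> le_m; rewrite /block !take_drop take_takel // addnC. Qed.

Lemma block_drop (A : finType) n m (u : seq A) i :
  block n (drop m u) i = block n u (i + m).
Proof. by rewrite /block drop_drop. Qed.

Lemma block0_id (A : finType) n (u : seq A) : size u = n -> block n u 0 = u.
Proof. by move=> <-; rewrite /block drop0 take_size. Qed.

Lemma size_block (A : finType) n (u : seq A) i :
  i + n <= size u -> size (block n u i) = n.
Proof. by move=> le_u; rewrite size_takel // size_drop; lia. Qed.

Lemma factorial_block (A : finType) (S : set (seq A)) n u i :
  factorial_set S -> S u -> S (block n u i).
Proof.
move=> Sfact Su; apply: (Sfact _ u) => //.
by apply: infix_trans (infix_drop u i); apply: prefixW; apply: prefix_take.
Qed.

Lemma factorial_take (A : finType) (S : set (seq A)) n u :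
  factorial_set S -> S u -> S (take n u).
Proof. by move=> Sfact Su; apply: (Sfact _ u) => //; apply: infix_take. Qed.

Lemma factorial_drop (A : finType) (S : set (seq A)) n u :
  factorial_set S -> S u -> S (drop n u).
Proof. by move=> Sfact Su; apply: (Sfact _ u) => //; apply: infix_drop. Qed.

(* By induction on i: the prefix of z ending with the first later window outside
   P would be in the code. *)
Lemma block_code_free (A : finType) (S : set (seq A)) n P z :
    factorial_set S -> S z -> n < size z ->
    (forall y, block_code S n P y -> ~ prefix y z) ->
  forall i, 0 < i -> i + n <= size z -> P (block n z i).
Proof.
move=> Sfact Sz lt_nz free.
have nP0 : ~~ P (block n z 0).
  apply/negP=> Pz; apply: (free (block n z 0)); last first.
    by rewrite /block drop0 prefix_take.
  split; first exact: factorial_block.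
  by left; split => //; apply: size_block; lia.
elim/ltn_ind=> i IH i_gt0 le_z; apply/negPn/negP=> nPi.
apply: (free (take (i + n) z)); last exact: prefix_take.
split; first exact: factorial_take.
right; rewrite size_takel //; split; first by lia.
move=> j le_j; rewrite block_take //.
have [->|j_gt0] := posnP j; first exact/negbTE.
have [lt_ji|le_ij] := ltnP j i; first by rewrite IH //; lia.
have -> : j = i by lia.
by rewrite (negbTE nPi); lia.
Qed.

(** The last window of a code word longer than [n] lies outside [P], but in a proper extension it
    would be an inner window. A code word of length [n] lies in [P], so it cannot be the first
    window of a longer one. *)
Lemma block_code_prefix (A : finType) (S : set (seq A)) n P :
  0 < n -> prefix_code (block_code S n P).
Proof.
move=> n_gt0; split=> [[_ [[sn _]|[]]]|x y] //; first by rewrite -sn in n_gt0.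
move=> [_ Cx] [_ Cy] [/prefixP[s def_y] neq_xy]; apply: neq_xy; subst y; move: Cy.
case: s => [|a s]; first by rewrite cats0.
rewrite size_cat /= => Cy; case: Cx => [[sx Px]|[lt_nx Bx]].
  case: Cy => [[]|[lt_n By]]; first by lia.
  have := By 0 ltac:(lia); rewrite /block drop0 take_cat sx ltnn subnn take0.
  by rewrite cats0 Px.
case: Cy => [[]|[lt_n By]]; first by lia.
have := Bx (size x - n) ltac:(lia); have := By (size x - n) ltac:(lia).
have -> : block n (x ++ a :: s) (size x - n) = block n x (size x - n).
  by rewrite -(@block_take _ n (size x)) ?take_size_cat //; lia.
by move=> ->; lia.
Qed.

(** Mirror image of the prefix case, with the first window of [x] in place of the last. *)
Lemma block_code_suffix (A : finType) (S : set (seq A)) n P :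
  0 < n -> suffix_code (block_code S n P).
Proof.
move=> n_gt0; split=> [[_ [[sn _]|[]]]|x y] //; first by rewrite -sn in n_gt0.
move=> [_ Cx] [_ Cy] [/suffixP[s def_y] neq_xy]; apply: neq_xy; subst y; move: Cy.
case: s => [//|a s].
rewrite size_cat /= => Cy.
have dropE : drop (size s).+1 ((a :: s) ++ x) = x by rewrite /= drop_size_cat.
case: Cx => [[sx Px]|[lt_nx Bx]].
  case: Cy => [[]|[lt_n By]]; first by lia.
  have := By (size s).+1; rewrite leq_add2l sx leqnn => /(_ isT).
  by rewrite -[(size s).+1]add0n -block_drop dropE block0_id // Px; lia.
case: Cy => [[]|[lt_n By]]; first by lia.
have := Bx 0 (ltnW lt_nx).
have := By (size s).+1; rewrite leq_add2l (ltnW lt_nx) => /(_ isT).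
by rewrite -[(size s).+1]add0n -block_drop dropE => ->; lia.
Qed.

(** * Finiteness and maximality *)

Lemma uniformly_recurrent_extend (A : finType) (S : set (seq A)) w m :
  uniformly_recurrent S -> S w -> exists2 v, size v = m & S (w ++ v).
Proof.
case=> _ Sext _ Sw; elim: m => [|m [v <- /Sext[a Sva]]].
  by exists [::]; rewrite ?cats0.
by exists (rcons v a); rewrite ?size_rcons // -rcons_cat.
Qed.

(** Without a code prefix, all windows of [z] after the first lie in [P]; uniform recurrence puts
    [q], which is outside [P], among them. *)
Lemma block_code_long (A : finType) (S : set (seq A)) n (P : pred (seq A)) q :
    uniformly_recurrent S -> S q -> size q = n -> ~~ P q ->
  exists2 N, n < N & forall z, S z -> N <= size z ->
    exists2 y, block_code S n P y & prefix y z.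
Proof.
move=> [Sfact _ Srec] Sq sq nPq; have [m m_gt0 inf_q] := Srec _ Sq.
exists (m + n).+1 => [|z Sz le_z]; first by lia.
apply: contrapT => noy.
have free y : block_code S n P y -> ~ prefix y z by move=> ? ?; apply: noy; exists y.
have lt_nz : n < size z by lia.
have Pz := block_code_free Sfact Sz lt_nz free.
(* The first letter is dropped so that [q] occurs at a positive position. *)
have Sz' : S (take m (drop 1 z)) by apply: factorial_take => //; apply: factorial_drop.
have sz' : size (take m (drop 1 z)) = m.
  by apply: size_takel; rewrite size_drop; lia.
have /infixP[s1 [s2 def_z']] := inf_q _ Sz' sz'.
have le_m : size s1 + n <= m.
  by rewrite -sz' def_z' !size_cat sq leq_add2l leq_addr.
have qE : block n z (size s1 + 1) = q.
  rewrite -block_drop -(@block_take _ n m) // def_z' /block drop_size_cat //.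
  by rewrite take_size_cat.
by move: nPq; rewrite -qE Pz //; lia.
Qed.

(** The prefix of length [N] of a longer code word would already have a code word as prefix, against
    the prefix property. *)
Lemma block_code_size_bounded (A : finType) (S : set (seq A)) n (P : pred (seq A)) q :
    uniformly_recurrent S -> 0 < n -> S q -> size q = n -> ~~ P q ->
  exists N, forall y, block_code S n P y -> size y <= N.
Proof.
move=> SU n_gt0 Sq sq nPq; have [N _ long] := block_code_long SU Sq sq nPq.
exists N => y Cy; rewrite leqNgt; apply/negP=> lt_Ny.
have [Sfact _ _] := SU.
have [||x Cx px] := long (take N y).
- by apply: factorial_take => //; case: Cy.
- by rewrite size_takel //; lia.
have [_ /(_ x y Cx Cy)] := @block_code_prefix _ S n P n_gt0; apply; split.
  by apply: prefix_trans px _; apply: prefix_take.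
move=> xy; have := size_prefix px.
by rewrite xy size_take lt_Ny => /(leq_trans lt_Ny); rewrite ltnn.
Qed.

Lemma prefix_comparable (T : eqType) (x y z : seq T) :
  prefix x z -> prefix y z -> prefix x y || prefix y x.
Proof.
elim: z x y => [|c z IH] [|a x] [|b y] //=.
by case/andP=> /eqP-> px /andP[/eqP-> py]; rewrite eqxx; apply: IH.
Qed.

(** A word of a larger code [Y], extended to the right within [S], acquires a prefix in the block
    code. The two are comparable for the prefix order, hence equal, because [Y] is a prefix code. *)
Lemma block_code_maximal (A : finType) (S : set (seq A)) n (P : pred (seq A)) q :
    uniformly_recurrent S -> 0 < n -> S q -> size q = n -> ~~ P q ->
  maximal_bifix_code S (block_code S n P).
Proof.
move=> SU n_gt0 Sq sq nPq; split.
- by split; [exact: block_code_prefix | exact: block_code_suffix].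
- by move=> u [].
move=> Y [[_ Ypre] _] YS; rewrite properEneq => -[/eqP neq sub]; apply: neq.
apply/seteqP; split=> // z Yz; have [N _ long] := block_code_long SU Sq sq nPq.
have [v sv Szv] := uniformly_recurrent_extend N SU (YS _ Yz).
have [|y Cy py] := long _ Szv; first by rewrite size_cat; lia.
have pz : prefix z (z ++ v) by apply: prefix_prefix.
have [<-//|neq_yz] := eqVneq y z.
case/orP: (prefix_comparable py pz) => pyz.
- by case: (Ypre y z (sub _ Cy) Yz); split=> //; apply/eqP.
- by case: (Ypre z y Yz (sub _ Cy)); split=> //; apply/eqP; rewrite eq_sym.
Qed.


(** * Parses and the degree *)

Lemma suffix_comparable (T : eqType) (x y z : seq T) :
  suffix x z -> suffix y z -> suffix x y || suffix y x.
Proof. by rewrite -!prefix_rev; apply: prefix_comparable. Qed.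

Lemma infix_size_eq (T : eqType) (x y : seq T) :
  infix x y -> size x = size y -> x = y.
Proof.
case/infixP=> s1 [s2 ->]; rewrite !size_cat => eq_s.
have s1_0 : size s1 = 0 by lia.
have s2_0 : size s2 = 0 by lia.
by rewrite (size0nil s1_0) (size0nil s2_0) cats0.
Qed.

Lemma cat_injr (T : eqType) (x y s : seq T) : x ++ s = y ++ s -> x = y.
Proof.
move/(congr1 rev)/eqP; rewrite !rev_cat eqseq_cat // eqxx /= => /eqP.
exact: (can_inj revK).
Qed.

(** Makes a parse depend only on its third component. The last factors of the two factorizations are
    comparable suffixes, hence equal, and are peeled off together; neither list can run out first,
    as [v1] and [v2] have no suffix in [X]. *)
Lemma suffix_code_decomposition (A : finType) (X : set (seq A)) v1 v2 x1 x2 :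
    suffix_code X -> kleene_star X x1 -> kleene_star X x2 ->
    (forall y, X y -> ~ suffix y v1) -> (forall y, X y -> ~ suffix y v2) ->
  v1 ++ x1 = v2 ++ x2 -> v1 = v2 /\ x1 = x2.
Proof.
move=> [_ Xsuf] [s1 Xs1 ->] [s2 Xs2 ->] free1 free2 {x1 x2}.
have last_suffix s y v : suffix y (v ++ flatten (rcons s y)).
  by rewrite flatten_rcons catA suffix_suffix.
elim/last_ind: s1 s2 Xs1 Xs2 => [|s1 y1 IH] s2 Xs1; case/lastP: s2 => [|s2 y2] Xs2.
- by rewrite !cats0.
- rewrite /= cats0 => def_v1; case: (free1 y2).
    by apply: Xs2; rewrite mem_rcons mem_head.
  by rewrite def_v1.
- rewrite /= cats0 => def_v2; case: (free2 y1).
    by apply: Xs1; rewrite mem_rcons mem_head.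
  by rewrite -def_v2.
move=> eq_vx; have Xy1 : X y1 by apply: Xs1; rewrite mem_rcons mem_head.
have Xy2 : X y2 by apply: Xs2; rewrite mem_rcons mem_head.
have eq_y : y1 = y2.
  have [//|/eqP neq] := eqVneq y1 y2.
  have suf1 : suffix y1 (v1 ++ flatten (rcons s1 y1)) by [].
  have suf2 : suffix y2 (v1 ++ flatten (rcons s1 y1)) by rewrite eq_vx.
  case/orP: (suffix_comparable suf1 suf2) => suf.
  - by case: (Xsuf _ _ Xy1 Xy2).
  - by case: (Xsuf _ _ Xy2 Xy1); split=> // eq; apply: neq.
move: eq_vx; rewrite !flatten_rcons eq_y !catA => /cat_injr eq_vx.
have [|||-> ->] // := IH s2.
- by move=> x s1x; apply: Xs1; rewrite mem_rcons inE s1x orbT.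
- by move=> x s2x; apply: Xs2; rewrite mem_rcons inE s2x orbT.
Qed.

Lemma block_code_degree_le (A : finType) (S : set (seq A)) n (P : pred (seq A)) w :
    factorial_set S -> 0 < n -> S w ->
  parses (block_code S n P) w #<= `I_n.+1.
Proof.
move=> Sfact n_gt0 Sw; set X := block_code S n P.
have Xsuf : suffix_code X by exact: block_code_suffix.
(* Truncating at [n] loses nothing: at most one possible third component has length at least [n]. *)
apply/pcard_leP/injfunPex; exists (fun p => minn (size p.2) n).
  by move=> p _ /=; rewrite ltnS geq_minr.
move=> [[v1 x1] u1] [[v2 x2] u2]; rewrite !inE /= => p1 p2 eq_min.
wlog le_u : v1 x1 u1 v2 x2 u2 p1 p2 eq_min / size u1 <= size u2.
  move=> W; have [le_u|/ltnW le_u] := leqP (size u1) (size u2).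
    exact: W.
  by apply: esym; apply: W.
case: p1 p2 => [w1 fv1 fu1 Xx1] [w2 fv2 fu2 Xx2].
have eq_u : u1 = u2.
  have u1E : u1 = drop (size u2 - size u1) u2.
    have: suffix u1 w /\ suffix u2 w.
      by rewrite {1}w1 w2 !catA !suffix_suffix.
    case=> s1 s2; have : suffix u1 u2.
      case/orP: (suffix_comparable s1 s2) => // s21.
      rewrite suffixE; have := size_suffix s21 => le21.
      have e12 : size u1 = size u2 by apply/eqP; rewrite eqn_leq le_u le21.
      by move: s21; rewrite !suffixE e12 subnn !drop0 eq_sym.
    by rewrite suffixE => /eqP.
  have [eq_s|neq_s] := eqVneq (size u1) (size u2).
    by rewrite u1E eq_s subnn drop0.
  have lt_u : size u1 < size u2 by rewrite ltn_neqAle neq_s.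
  have le_n : n <= size u1 by move: eq_min; lia.
  have Su2 : S u2.
    by apply: (Sfact _ w) => //; rewrite w2 catA; apply/suffixW/suffix_suffix.
  have lt_n2 : n < size u2 by lia.
  have le_2 : size u2 - size u1 + n <= size u2 by lia.
  have gt_0 : 0 < size u2 - size u1 by lia.
  have Pu1 := block_code_free Sfact Su2 lt_n2 fu2 gt_0 le_2.
  (* The first window of [u1] is a later window of [u2], so it is in [P] and is a code word. *)
  case: (fu1 (block n u2 (size u2 - size u1))).
    split; first exact: factorial_block.
    by left; split=> //; apply: size_block.
  by rewrite /block -u1E prefix_take.
rewrite -eq_u in w2 *.
have [|-> -> //] := suffix_code_decomposition Xsuf Xx1 Xx2 fv1 fv2.
by apply: (@cat_injr _ _ _ u1); rewrite -!catA -w1.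
Qed.

Lemma block_code_degree (A : finType) (S : set (seq A)) n (P : pred (seq A)) q :
    factorial_set S -> 0 < n -> S q -> size q = n -> ~~ P q ->
  has_degree S (block_code S n P) n.+1.
Proof.
move=> Sfact n_gt0 Sq sq nPq; split=> [|w Sw]; last exact: block_code_degree_le.
exists q => //; rewrite card_eq_le block_code_degree_le //=.
suff /injfunPex[f] : exists2 f : nat -> seq A * seq A * seq A,
    set_fun `I_n.+1 (parses (block_code S n P) q) f & set_inj `I_n.+1 f.
  exact: inj_card_le f.
(* No code word is a factor of [q], so each of the [n.+1] cuts of [q] is a parse with empty
   middle. *)
exists (fun j => (take j q, [::], drop j q)); last first.
  move=> i j; rewrite !inE /= => lt_i lt_j [/(congr1 size) + _].
  by rewrite !size_takel ?sq.
have free y : block_code S n P y -> ~ infix y q.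
  move=> [_ Cy] inf_y; have le_y := size_infix inf_y.
  case: Cy => [[sy Py]|[lt_n _]]; last by move: le_y; rewrite sq leqNgt lt_n.
  by move: nPq; rewrite -(infix_size_eq inf_y) ?Py // sy.
move=> j _ /=; split.
- by rewrite cat_take_drop.
- by move=> y Cy sy; apply: (free y Cy); apply: infix_trans (suffixW sy) (infix_take _ _).
- by move=> y Cy py; apply: (free y Cy); apply: infix_trans (prefixW py) (infix_drop _ _).
- by exists [::].
Qed.


(** * Counting words of bounded length *)

Lemma card_finpred (T : finType) (c : pred T) : [set t | c t] #= `I_#|c|.
Proof.
have c_enum t : c t = (t \in enum c) by rewrite mem_enum.
have inj : {in [set t | c t] &, injective (fun t => index t (enum c))}.
  move=> s t; rewrite !inE /= !c_enum => cs ct eq_i.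
  by rewrite -(nth_index s cs) eq_i nth_index.
apply: card_esym; rewrite -(card_eqr (inj_card_eq inj)) cardE.
suff -> : `I_(size (enum c)) = [set index t (enum c) | t in [set t | c t]] by [].
apply/seteqP; split=> [i lt_i|_ [t /= ct <-]] /=; last first.
  by rewrite index_mem -c_enum.
have [t _] : exists t, t \in enum c.
  by case: (enum c) lt_i => // t s _; exists t; rewrite mem_head.
exists (nth t (enum c) i); first by rewrite /= c_enum mem_nth.
by rewrite index_uniq // enum_uniq.
Qed.

(** Bounding the length by [N] gives a finite index type common to all sets of words, so that
    cardinalities can be compared term by term. *)
Definition word_count (A : finType) (N : nat) (X : set (seq A)) : nat :=
  #|[pred t : N.-bseq A | `[< X t >]]|.

Lemma word_count_sum (A : finType) N (X : set (seq A)) :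
  word_count N X = \sum_(t : N.-bseq A) `[< X t >].
Proof. by rewrite /word_count -sum1_card big_mkcond. Qed.

Lemma card_eq_word_count (A : finType) N (X : set (seq A)) :
  (forall u, X u -> size u <= N) -> X #= `I_(word_count N X).
Proof.
move=> leN; have cardX := card_finpred [pred t : N.-bseq A | `[< X t >]].
have XE : X = [set (t : seq A) | t in [set t : N.-bseq A | `[< X t >]]].
  apply/seteqP; split=> [u Xu|_ [t /= /asboolP Xt <-]] //.
  by exists (Bseq (leN _ Xu)) => //=; apply/asboolP.
rewrite -(card_eqr cardX) {1}XE; apply: inj_card_eq => s t _ _; exact: val_inj.
Qed.

Lemma word_countP (A : finType) N (X : set (seq A)) m :
  (forall u, X u -> size u <= N) -> X #= `I_m -> word_count N X = m.
Proof.
move=> leN Xm; apply/card_eq_II; rewrite -(card_eqr Xm).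
by apply: card_esym; apply: card_eq_word_count.
Qed.

Lemma word_count_image (A T : finType) N (X : set (seq A)) (c : pred T)
    (f : T -> seq A) :
    injective f -> (forall u, X u <-> exists2 t, c t & u = f t) ->
    (forall t, size (f t) <= N) ->
  word_count N X = #|c|.
Proof.
move=> f_inj XE leN; apply: word_countP => [u /XE[t _ ->] //|].
have -> : X = f @` [set t | c t].
  by apply/seteqP; split=> u => [/XE[t ct ->]|[t ct <-]]; [exists t|apply/XE; exists t].
by rewrite (card_eql (inj_card_eq _)) ?card_finpred // => s t _ _ /f_inj.
Qed.

Lemma word_count_left_ext (A : finType) (S : set (seq A)) p N :
    size p < N ->
  word_count N [set u | [/\ S u, size u = (size p).+1 & block (size p) u 1 = p]] =
  left_ext S p.
Proof.
move=> lt_N; apply: (word_count_image (f := fun a => a :: p)) => [a b []||] //=.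
move=> u; split=> [[Su su bu]|[a /asboolP Sa ->]].
  case: u Su su bu => // a u Su [su]; rewrite /block drop1 /= take_oversize ?su //.
  by move=> <-; exists a => //; apply/asboolP.
by rewrite /block /= drop0 take_size.
Qed.

Lemma word_count_right_ext (A : finType) (S : set (seq A)) p N :
    size p < N ->
  word_count N [set u | [/\ S u, size u = (size p).+1 & block (size p) u 0 = p]] =
  right_ext S p.
Proof.
move=> lt_N; apply: (word_count_image (f := rcons p)) => [a b /rcons_inj[]||] //=.
  move=> u; split=> [[Su su bu]|[a /asboolP Sa ->]].
    case/lastP: u Su su bu => // u a Su; rewrite size_rcons => -[su].
    rewrite /block drop0 -cats1 takel_cat ?su // take_oversize ?su // => u_p.
    by exists a; rewrite -u_p ?cats1 //; apply/asboolP.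
  split; rewrite ?size_rcons // /block /= drop0 -cats1 take_size_cat //.
by move=> a; rewrite size_rcons.
Qed.

Lemma word_count_bi_ext (A : finType) (S : set (seq A)) p N :
    (size p).+1 < N ->
  word_count N [set u | [/\ S u, size u = (size p).+2 & block (size p) u 1 = p]] =
  bi_ext S p.
Proof.
move=> lt_N; apply: (word_count_image (f := fun c => c.1 :: rcons p c.2)).
- by move=> [a b] [c d] /= [-> /rcons_inj[->]].
- move=> u; split=> [[Su su bu]|[[a b] /asboolP Sab ->]].
    case: u Su su bu => // a u; case/lastP: u => // u b Sab /=.
    rewrite size_rcons => -[su]; rewrite /block /= drop0 -cats1.
    rewrite takel_cat ?su // take_oversize ?su // => u_p.
    by exists (a, b); rewrite -u_p ?cats1 //; apply/asboolP.
  split; rewrite /= ?size_rcons // /block /= drop0 -cats1 take_size_cat //.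
- by move=> [a b]; rewrite /= size_rcons.
Qed.

(** * The codes compared length by length *)

Lemma block_code0 (A : finType) (S : set (seq A)) n :
  block_code S n pred0 = [set u | S u /\ size u = n.+1].
Proof.
apply/seteqP; split=> u /= [Su Cu]; split=> //.
  case: Cu => [[]|[lt_n Bu]] //; have := Bu 1.
  by rewrite add1n lt_n => /(_ isT) /=; lia.
by right; rewrite Cu; split=> // i le_i /=; lia.
Qed.

(** Meant for words of length [n.+1], whose two windows of length [n] it tests; for [pred1 p] it is
    the set P' above. *)
Definition both_blocks (A : finType) n (P : pred (seq A)) : pred (seq A) :=
  [pred v | P (take n v) && P (drop 1 v)].

Lemma both_blocksE (A : finType) n P (u : seq A) i :
  both_blocks n P (block n.+1 u i) = P (block n u i) && P (block n u i.+1).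
Proof.
have shift : drop 1 (take n.+1 (drop i u)) = take n (drop i.+1 u).
  by rewrite -[i.+1]add1n -drop_drop [RHS]take_drop addn1.
by rewrite /both_blocks /block /= shift take_takel.
Qed.

Lemma block_code_lt (A : finType) (S : set (seq A)) n P u :
  size u < n -> `[< block_code S n P u >] = false.
Proof. by move=> lt_u; apply/asboolPn=> -[_ [[]|[]]]; lia. Qed.

Lemma block_code_eq (A : finType) (S : set (seq A)) n P u :
  S u -> size u = n -> `[< block_code S n P u >] = P u.
Proof.
move=> Su su; apply/asboolP/idP => [[_ [[]|[]]]|Pu] //; first by lia.
by split=> //; left.
Qed.

Lemma block_code_eqS (A : finType) (S : set (seq A)) n P u :
    S u -> size u = n.+1 ->
  `[< block_code S n P u >] = ~~ P (block n u 0) && ~~ P (block n u 1).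
Proof.
move=> Su su; apply/asboolP/idP => [[_ [[]|[_ Bu]]]|/andP[P0 P1]]; first by lia.
  by rewrite !Bu su //; lia.
split=> //; right; rewrite su; split=> // -[|[|i]]  le_i; lia.
Qed.

Lemma block_code_eqSS (A : finType) (S : set (seq A)) n P u :
    S u -> size u = n.+2 ->
  `[< block_code S n P u >] =
    [&& ~~ P (block n u 0), P (block n u 1) & ~~ P (block n u 2)].
Proof.
move=> Su su; apply/asboolP/idP => [[_ [[]|[_ Bu]]]|/and3P[P0 P1 P2]]; first by lia.
  by rewrite !Bu su; lia.
split=> //; right; rewrite su; split=> [|[|[|[|i]]] le_i]; lia.
Qed.

(** From length [n + 3] on there is an inner window of length [n.+1], and every inner window of
    length [n] lies in one. An extreme window of length [n.+1] then fails exactly because its outer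
    half is not in [P]. *)
Lemma block_code_both_blocks (A : finType) (S : set (seq A)) n P u :
    n.+2 < size u ->
  `[< block_code S n.+1 (both_blocks n P) u >] = `[< block_code S n P u >].
Proof.
move=> lt_u; apply/asboolP/asboolP=> -[Su [[]|[_ Bu]]]; (try by lia); split=> //; right.
  split=> [|i le_i]; first by lia.
  have {}Bu j : j + n < size u ->
    P (block n u j) && P (block n u j.+1) = (0 < j < size u - n.+1).
    by move=> lt_j; rewrite -both_blocksE Bu //; lia.
  have Pmid j : 0 < j < size u - n -> P (block n u j).
    move=> j_mid; have [lt_j|le_j] := ltnP j (size u - n.+1).
      by have := Bu j ltac:(lia); rewrite lt_j; case: (P _) => //; lia.
    have := Bu j.-1 ltac:(lia); rewrite prednK; last by lia.
    by case: (P (block n u j)) => //; rewrite andbF; lia.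
  have [/Pmid -> //|] := boolP (0 < i < size u - n).
  have [->|i_gt0] := posnP i.
    by have := Bu 0 ltac:(lia); rewrite (Pmid 1) ?andbT //; lia.
  move=> i_end; have := Bu i.-1 ltac:(lia).
  by rewrite prednK // (Pmid i.-1) //=; lia.
split=> [|i le_i]; first by lia.
by rewrite both_blocksE !Bu; lia.
Qed.


(** * Cardinalities of the codes and neutrality *)

Lemma block_code_count (A : finType) (S : set (seq A)) n (P : pred (seq A)) q :
    uniformly_recurrent S ->
    (forall (d : nat) (X : set (seq A)),
        finite_set X -> maximal_bifix_code S X -> has_degree S X d ->
        X #= `I_(d * (#|A| - 1) + 1)) ->
    0 < n -> S q -> size q = n -> ~~ P q ->
  exists N0, forall N, N0 <= N ->
    word_count N (block_code S n P) = n.+1 * (#|A| - 1) + 1.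
Proof.
move=> SU Hcard n_gt0 Sq sq nPq; have [Sfact _ _] := SU.
have [N0 bound] := block_code_size_bounded SU n_gt0 Sq sq nPq.
(* From [N0] on the count is the true cardinality; the threshold form lets several codes share one
   [N]. *)
exists N0 => N le_N; apply: word_countP => [u /bound le_u|].
  exact: leq_trans le_u le_N.
apply: Hcard.
- by apply/finite_setP; exists (word_count N0 (block_code S n P)); apply: card_eq_word_count.
- exact: block_code_maximal sq nPq.
- exact: block_code_degree sq nPq.
Qed.

(* Holds pointwise: every word contributes equally to both sides. *)
Lemma word_count_block_codes (A : finType) (S : set (seq A)) p N :
    let n := size p in S p ->
  word_count N (block_code S n (pred1 p)) +
  word_count N (block_code S n.+1 pred0) +
  word_count N [set u | [/\ S u, size u = n.+1 & block n u 1 = p]] +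
  word_count N [set u | [/\ S u, size u = n.+1 & block n u 0 = p]] =
  word_count N (block_code S n.+1 (both_blocks n (pred1 p))) +
  word_count N (block_code S n pred0) +
  word_count N [set p] +
  word_count N [set u | [/\ S u, size u = n.+2 & block n u 1 = p]].
Proof.
move=> n Sp; rewrite !block_code0 !word_count_sum -!big_split /=.
apply: eq_bigr => t _; move: {t}(t : seq A) => u.
have extE m i : `[< [/\ S u, size u = m & block n u i = p] >] =
    [&& `[< S u >], size u == m & block n u i == p].
  apply/asboolP/and3P => [[Su /eqP su /eqP bu]|[/asboolP Su /eqP su /eqP bu]] //.
  by split=> //; apply/asboolP.
have sizeE m : `[< S u /\ size u = m >] = `[< S u >] && (size u == m).
  by apply/asboolP/andP => -[/asboolP Su /eqP su].
have singleE : `[< u = p >] = (u == p) by apply/asboolP/eqP.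
rewrite /= !extE !sizeE singleE.
have [Su|nSu] := pselect (S u); last first.
  have codeF m P : `[< block_code S m P u >] = false by apply/asboolPn=> -[].
  have -> : `[< S u >] = false by apply/asboolPn.
  have -> : (u == p) = false by apply/eqP=> def_u; rewrite def_u in nSu.
  by rewrite !codeF.
have -> : `[< S u >] = true by apply/asboolP.
rewrite /=; have [lt_u|gt_u|eq_u] := ltngtP (size u) n.
- rewrite !block_code_lt ?(ltnW lt_u) //; last by rewrite ltnS ltnW.
  have -> : (u == p) = false by apply/eqP=> def_u; rewrite def_u ltnn in lt_u.
  by rewrite !ltn_eqF // !ltnS ltnW // ltnW.
- have -> : (u == p) = false by apply/eqP=> def_u; rewrite def_u ltnn in gt_u.
  have [lt_u|gt_u1|eq_u] := ltngtP (size u) n.+1; first by rewrite ltnNge gt_u in lt_u.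
    have [lt_u|gt_u2|eq_u] := ltngtP (size u) n.+2; first by rewrite ltnNge gt_u1 in lt_u.
      by rewrite block_code_both_blocks // !addn0.
    (* Length [n + 2]: if the middle window is [p], both sides are 1 plus the indicator that neither
       outer window is [p]; otherwise both are 1. *)
    rewrite block_code_eqSS // (block_code_eqS _ Su eq_u) !both_blocksE /=.
    by do 3!case: (_ == p).
  (* Length [n + 1]: inclusion-exclusion for the two windows being equal to [p]. *)
  rewrite block_code_eqS // block_code_eq // ltn_eqF ?eq_u //.
  rewrite -[in both_blocks _ _ u](block0_id eq_u) both_blocksE /=.
  by do 2!case: (_ == p).
rewrite block_code_eq // block_code_lt ?eq_u //.
by rewrite !(@ltn_eqF n) //= !addn0.
Qed.

(** Treated apart because over one letter no word of length [n] differs from [p]. Here a nonempty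
    [S] contains all words, and neutrality reads 1 = 1 + 1 - 1. *)
Lemma neutral_subsingleton (A : finType) (S : set (seq A)) :
  #|A| <= 1 -> uniformly_recurrent S -> neutral S.
Proof.
move=> A_le1 [Sfact Sext _]; split=> // w Sw.
have eqA := fintype_le1P A_le1.
have Sall u : S u.
  elim/last_ind: u => [|u a Su]; first exact: Sfact _ _ Sw (infix0s w).
  by have [b] := Sext u Su; rewrite (eqA b a).
have A1 : #|A| = 1.
  have [a _] := Sext w Sw; apply/eqP; rewrite eqn_leq A_le1.
  by apply/card_gt0P; exists a.
have -> : left_ext S w = 1 by rewrite -A1; apply: eq_card => a; rewrite !inE; apply/asboolP.
have -> : right_ext S w = 1 by rewrite -A1; apply: eq_card => a; rewrite !inE; apply/asboolP.
have -> : bi_ext S w = 1; last by [].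
rewrite -[RHS]/(1 * 1) -A1 -card_prod.
by apply: eq_card => a; rewrite !inE; apply/asboolP.
Qed.

Theorem theorem3p12 (A : finType) (S : set (seq A))
    (HS : uniformly_recurrent S)
    (HA : forall a : A, S [:: a])
    (Hcard : forall (d : nat) (X : set (seq A)),
        finite_set X -> maximal_bifix_code S X -> has_degree S X d ->
        X #= `I_(d * (#|A| - 1) + 1)) :
  neutral S.
Proof.
have [A1|A2] := leqP #|A| 1; first exact: neutral_subsingleton.
have [Sfact Sext _] := HS; split=> // p Sp.
have [a [b [_ _ neq_ab]]] : exists a b : A, [/\ a \in A, b \in A & a != b].
  by apply/card_gt1P.
have S_size n : exists2 q, S q & size q = n.
  have [q sq Sq] := uniformly_recurrent_extend n HS (Sfact [::] p Sp (infix0s p)).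
  by exists q.
suff: (bi_ext S p).+1 = left_ext S p + right_ext S p by lia.
have [p0|p_gt0] := posnP (size p).
  have [q Sq sq] := S_size 1.
  have [N0 count1] := block_code_count HS Hcard (ltnSn 0) Sq sq (isT : ~~ pred0 q).
  have := count1 (maxn N0 3) (leq_maxl _ _).
  rewrite (size0nil p0) in Sp *.
  (* Words of length 2 are the two-sided extensions of the empty word; the condition on the window
     of length 0 is vacuous. The degree is 2, so their number is [2 * (#|A| - 1) + 1]. *)
  have -> : block_code S 1 pred0 = [set u | [/\ S u, size u = 2 & block 0 u 1 = [::]]].
    rewrite block_code0; apply/seteqP; split=> u /=; last by case.
    by case=> Su su; split=> //; rewrite /block take0.
  rewrite (@word_count_bi_ext _ S [::]) ?leq_max ?orbT // => ->.
  have -> : left_ext S [::] = #|A| by apply: eq_card => c; rewrite !inE; apply/asboolP.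
  have -> : right_ext S [::] = #|A|.
    by apply: eq_card => c; rewrite !inE; apply/asboolP; apply: (HA c).
  by lia.
set n := size p.
(* Words of [S] of length [n] starting with [a] and with [b] cannot both be [p]. *)
have [q [Sq sq nPq]] : exists q, [/\ S q, size q = n & ~~ pred1 p q].
  have ext_letter c : exists2 v, size v = n.-1 & S (c :: v).
    exact: uniformly_recurrent_extend (HA c).
  have [[va sa Sa] [vb sb Sb]] := (ext_letter a, ext_letter b).
  have [def_p|neq_p] := eqVneq (a :: va) p; last first.
    by exists (a :: va); split; rewrite //= sa prednK.
  exists (b :: vb); split; rewrite //= ?sb ?prednK // -def_p.
  by apply: contra neq_ab => /eqP[->].
have [c Sqc] := Sext q Sq.
have sqc : size (rcons q c) = n.+1 by rewrite size_rcons sq.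
(* The extension of [q] starts with [q], not with [p]. *)
have nPqc : ~~ both_blocks n (pred1 p) (rcons q c).
  by apply: contra nPq => /andP[+ _]; rewrite -cats1 -sq take_size_cat.
have [N1 count1] := block_code_count HS Hcard p_gt0 Sq sq nPq.
have [N2 count2] := block_code_count HS Hcard p_gt0 Sq sq (isT : ~~ pred0 q).
have [N3 count3] := block_code_count HS Hcard (ltn0Sn n) Sqc sqc nPqc.
have [N4 count4] :=
  block_code_count HS Hcard (ltn0Sn n) Sqc sqc (isT : ~~ pred0 (rcons q c)).
pose N := N1 + N2 + N3 + N4 + n.+2.
have := word_count_block_codes N Sp; rewrite /= -/n.
(* Each side has one code of degree [n.+1] and one of degree [n.+2], so the code cardinalities
   cancel. *)
rewrite count1 ?count2 ?count3 ?count4; try by rewrite /N; lia.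
rewrite word_count_left_ext ?word_count_right_ext ?word_count_bi_ext; try by rewrite /N /n; lia.
have -> : word_count N [set p] = 1; last by lia.
apply: word_countP card_set1 => u ->; rewrite /N /n; lia.
Qed.
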